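(* Let $(X,d_X)$ be a metric space and let $d\in\mathcal M(X)$ be a selfadjoint metric ($d^*=d$) such that $[d]_q$ is a projection in $M^q(X)$. For $n\in\mathbb N$ set $A_n=\{x\in X: d(x,x')\leq n\}$. Then $\mathcal A=\{A_n\}_{n\in\mathbb N}$ is an expanding sequence, and $d\sim_q d_{\mathcal A}$.
   Context: Let $(X,d_X)$ be a metric space. Identify $X$ with $X\times\{0\}$, write $X'$ for $X\times\{1\}$, $x$ for $(x,0)$ and $x'$ for $(x,1)$. $\mathcal M(X)$ is the set of all metrics $d$ on $X\times\{0,1\}$ whose restriction to each of the two copies of $X$ equals $d_X$ and for which the distance between the two copies, $\inf_{x,y\in X}d(x,y')$, is non-zero. The adjoint $d^*$ is given by $d^*(x,y')=d(y,x')$. Quasi-equivalence: $d_1\sim_q d_2$ if there exist $\alpha>0$, $\beta\geq 1$ with $-\alpha+\frac1\beta d_1(x,y')\leq d_2(x,y')\leq \alpha+\beta d_1(x,y')$ for all $x,y\in X$. $[d]_q$ is the class of $d$, and $M^q(X)$ is the set of all classes. $M^q(X)$ is an inverse semigroup under $[\rho]_q[d]_q=[\rho d]_q$, where $(\rho d)(x,y')=\inf_{z\in X}[d(x,z')+\rho(z,y')]$. A class is selfadjoint if it contains some $d$ with $d^*=d$; a projection is a selfadjoint idempotent. For $A\subset X$ and $r\ge 0$, $N_r(A)=\{x\in X: d_X(x,A)\leq r\}$. A sequence $\mathcal A=\{A_n\}_{n\in\mathbb N}$ of subsets of $X$ is an expanding sequence if (e1) $A_n$ is not empty for some $n$; (e2)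 $N_{1/2}(A_n)\subset A_{n+1}$ for every $n$ for which $A_n$ is non-empty. Given such a sequence (with $\bigcup_n A_n=X$), define $\delta_{\mathcal A}:X\to[1,\infty)$ by $\delta_{\mathcal A}(u)=1$ if $u\in A_1$, and $\delta_{\mathcal A}(u)=n+1$ if $u\in A_{n+1}\setminus A_n$, and define $d_{\mathcal A}\in\mathcal M(X)$ by $d_{\mathcal A}(x,y')=\inf_{u\in X}[d_X(x,u)+\delta_{\mathcal A}(u)+d_X(u,y)]$. *)

(* Defs.v *)
From HB Require Import structures.
From mathcomp Require Import all_boot all_order all_algebra.
From mathcomp Require Import generic_quotient.
From mathcomp Require Import lra.
From mathcomp Require Import boolp classical_sets reals ereal topology.

Set Implicit Arguments.
Unset Strict Implicit.
Unset Printing Implicit Defensive.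

Import Order.TTheory GRing.Theory Num.Theory.

Local Open Scope classical_set_scope.
Local Open Scope ring_scope.

Definition is_metric (R : realType) (T : Type) (d : T -> T -> R) :=
  [/\ forall p q, 0 <= d p q,
      forall p q, d p q = 0 <-> p = q,
      forall p q, d p q = d q p &
      forall p q r, d p r <= d p q + d q r].

(* M(X).  The point (x, 0) of the double of X is (x, false), and
   x' = (x, 1) is (x, true).  The infimum is the one of [reals], for which
   inf set0 = 0: there is therefore no element of M(X) when X is empty. *)
Record dmetric (R : realType) (X : metricType R) := DMetric {
  dfun :> X * bool -> X * bool -> R;
  dmetric_metric : is_metric dfun;
  dmetric_copy : forall (b : bool) x y, dfun (x, b) (y, b) = mdist x y;
  dmetric_gap :
    inf [set dfun (x, false) (y, true) | x in [set: X] & y in [set: X]] != 0 }.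

HB.instance Definition _ (R : realType) (X : metricType R) :=
  gen_eqMixin (dmetric X).
HB.instance Definition _ (R : realType) (X : metricType R) :=
  gen_choiceMixin (dmetric X).

(* d(x, y') *)
Definition cross (R : realType) (X : metricType R) (d : dmetric X) (x y : X) :=
  d (x, false) (y, true).

Section inf_range.
Context (R : realType) (T : Type).
Implicit Types (F : T -> R) (m : R).

Lemma inf_range_ge F m (t : T) : (forall u, m <= F u) -> m <= inf (range F).
Proof.
by move=> h; apply: lb_le_inf; [exists (F t), t | move=> _ [u _ <-]].
Qed.

Lemma inf_range_le F m u : (forall u, m <= F u) -> inf (range F) <= F u.
Proof.
by move=> h; apply: ge_inf; [exists m => _ [v _ <-] | exists u].
Qed.

End inf_range.

Section dmetric_theory.
Context (R : realType) (X : metricType R).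
Implicit Types d e rho : dmetric X.

Lemma cross_ge0 d x y : 0 <= cross d x y.
Proof. by case: (dmetric_metric d) => h _ _ _; exact: h. Qed.

Lemma cross_sym d x y : d (y, true) (x, false) = cross d x y.
Proof. by case: (dmetric_metric d) => _ _ h _; exact: h. Qed.

Lemma cross_triangle d : [/\
  forall x z y, cross d x y <= mdist x z + cross d z y,
  forall x z y, cross d x y <= cross d x z + mdist z y,
  forall x z y, mdist x z <= cross d x y + cross d z y &
  forall y z x, mdist y z <= cross d x y + cross d x z].
Proof.
case: (dmetric_metric d) => _ _ _ tri; split => [x z y|x z y|x z y|y z x].
- by rewrite -(dmetric_copy d false); exact: tri.
- by rewrite -(dmetric_copy d true); exact: tri.
- by rewrite -(dmetric_copy d false) -(cross_sym d z); exact: tri.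
- by rewrite -(dmetric_copy d true) -(cross_sym d x y); exact: tri.
Qed.


Lemma dmetric_gapP d : exists2 c, 0 < c & forall x y, c <= cross d x y.
Proof.
set S := [set d (x, false) (y, true) | x in [set: X] & y in [set: X]].
have lbS : lbound S 0 by move=> _ [x _ [y _ <-]]; exact: cross_ge0.
have leS x y : inf S <= cross d x y.
  by apply: ge_inf; [exists 0 | exists x => //; exists y].
exists (inf S) => //; rewrite lt_neqAle eq_sym (dmetric_gap d) /=.
case: (pselect (S !=set0)) => [S0|S0]; first by apply: lb_le_inf.
by rewrite (_ : S = set0) ?inf0//; apply: contra_notP S0 => /eqP/set0P.
Qed.

Lemma dmetric_nonempty d : exists x : X, True.
Proof.
apply: contrapT => nX; have /eqP := dmetric_gap d; apply.
set S := (S in inf S); rewrite (_ : S = set0) ?inf0//.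
by apply/seteqP; split => // r [x]; case: nX; exists x.
Qed.

(* The metric which is d_X on each copy of X and f(x, y) between x and y'. *)
Section glue.
Variable f : X -> X -> R.
Hypothesis nX : exists x : X, True.
Hypothesis f_ge : exists2 c, 0 < c & forall x y, c <= f x y.
Hypothesis f_tri1 : forall x z y, f x y <= mdist x z + f z y.
Hypothesis f_tri2 : forall x z y, f x y <= f x z + mdist z y.
Hypothesis f_tri3 : forall x z y, mdist x z <= f x y + f z y.
Hypothesis f_tri4 : forall y z x, mdist y z <= f x y + f x z.

Definition glue_fun (p q : X * bool) : R :=
  match p, q with
  | (x, false), (y, true) => f x y
  | (x, true), (y, false) => f y x
  | (x, _), (y, _) => mdist x y
  end.

Fact glue_metric : is_metric glue_fun.
Proof.
have f_gt0 x y : 0 < f x y by case: f_ge => c c0 h; exact: lt_le_trans (h x y).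
split.
- by move=> [x [] ] [y [] ] /=; rewrite ?mdist_ge0// ltW.
- move=> [x b] [y b']; split => [|[<- <-]]; last by case: b; rewrite /= mdistxx.
  case: b b' => [] [] /=.
  + by move/mdist_positivity ->.
  + by move=> h; have := f_gt0 y x; rewrite h ltxx.
  + by move=> h; have := f_gt0 x y; rewrite h ltxx.
  + by move/mdist_positivity ->.
- by move=> [x [] ] [y [] ] //=; rewrite metric_sym.
- move=> [x [] ] [y [] ] [z [] ] /=.
  + exact: metric_triangle.
  + by rewrite addrC (metric_sym x); exact: f_tri2.
  + exact: f_tri4.
  + by rewrite addrC (metric_sym y); exact: f_tri1.
  + exact: f_tri2.
  + exact: f_tri3.
  + exact: f_tri1.
  + exact: metric_triangle.
Qed.

Fact glue_copy (b : bool) x y : glue_fun (x, b) (y, b) = mdist x y.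
Proof. by case: b. Qed.

Fact glue_gap :
  inf [set glue_fun (x, false) (y, true) | x in [set: X] & y in [set: X]] != 0.
Proof.
case: nX f_ge => x _ [c c0 h]; apply: lt0r_neq0; apply: (lt_le_trans c0).
apply: lb_le_inf; first by exists (f x x), x => //; exists x.
by move=> _ [u _ [v _ <-]]; exact: h.
Qed.

Definition glue : dmetric X := DMetric glue_metric glue_copy glue_gap.

Lemma cross_glue x y : cross glue x y = f x y. Proof. by []. Qed.

End glue.

Section adjoint.
Variable d : dmetric X.

Let f x y := cross d y x.

Fact adj_ge : exists2 c, 0 < c & forall x y, c <= f x y.
Proof. by have [c c0 h] := dmetric_gapP d; exists c => // x y; exact: h. Qed.

Fact adj_tri1 x z y : f x y <= mdist x z + f z y.
Proof. by rewrite addrC metric_sym; case: (cross_triangle d) => _ h _ _; exact: h. Qed.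

Fact adj_tri2 x z y : f x y <= f x z + mdist z y.
Proof. by rewrite addrC metric_sym; case: (cross_triangle d) => h _ _ _; exact: h. Qed.

Fact adj_tri3 x z y : mdist x z <= f x y + f z y.
Proof. by case: (cross_triangle d) => _ _ _ h; exact: h. Qed.

Fact adj_tri4 y z x : mdist y z <= f x y + f x z.
Proof. by case: (cross_triangle d) => _ _ h _; exact: h. Qed.

Definition adj : dmetric X :=
  glue (dmetric_nonempty d) adj_ge
    adj_tri1 adj_tri2 adj_tri3 adj_tri4.

Lemma cross_adj x y : cross adj x y = cross d y x. Proof. by []. Qed.

End adjoint.

Section product.
Variables rho d : dmetric X.

(* (rho d)(x, y') *)
Let f x y := inf (range (fun z => cross d x z + cross rho z y)).

Let f_le x y z : f x y <= cross d x z + cross rho z y.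
Proof.
by apply: (@inf_range_le _ _ _ 0) => u; rewrite addr_ge0// cross_ge0.
Qed.

Let le_f m x y : (forall z, m <= cross d x z + cross rho z y) -> m <= f x y.
Proof. by case: (dmetric_nonempty d) => t _; exact: inf_range_ge. Qed.

Fact mul_ge : exists2 c, 0 < c & forall x y, c <= f x y.
Proof.
have [c c0 hc] := dmetric_gapP d; exists c => // x y; apply: le_f => z.
by have := hc x z; have := cross_ge0 rho z y; lra.
Qed.

Fact mul_tri1 x z y : f x y <= mdist x z + f z y.
Proof.
rewrite -lerBlDl; apply: le_f => u.
have [h _ _ _] := cross_triangle d.
by have := f_le x y u; have := h x z u; lra.
Qed.

Fact mul_tri2 x z y : f x y <= f x z + mdist z y.
Proof.
rewrite -lerBlDr; apply: le_f => u.
have [_ h _ _] := cross_triangle rho.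
by have := f_le x y u; have := h u z y; lra.
Qed.

Fact mul_tri3 x z y : mdist x z <= f x y + f z y.
Proof.
rewrite -lerBlDr; apply: le_f => u; rewrite lerBlDr -lerBlDl; apply: le_f => v.
have [_ h h' _] := cross_triangle d; have [_ _ k _] := cross_triangle rho.
by have := h x v u; have := h' x z v; have := k u v y; have := h x u v;
  rewrite (metric_sym v u); lra.
Qed.

Fact mul_tri4 y z x : mdist y z <= f x y + f x z.
Proof.
rewrite -lerBlDr; apply: le_f => u; rewrite lerBlDr -lerBlDl; apply: le_f => v.
have [h _ _ h'] := cross_triangle rho; have [_ _ _ k] := cross_triangle d.
by have := h u v y; have := h v u y; have := h' y z v; have := k u v x;
  rewrite (metric_sym v u); lra.
Qed.

Definition dmul : dmetric X :=
  glue (dmetric_nonempty d) mul_ge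
    mul_tri1 mul_tri2 mul_tri3 mul_tri4.

Lemma cross_mul x y :
  cross dmul x y = inf (range (fun z => cross d x z + cross rho z y)).
Proof. by []. Qed.

Lemma cross_mul_le x y z : cross dmul x y <= cross d x z + cross rho z y.
Proof. exact: f_le. Qed.

Lemma le_cross_mul m x y :
  (forall z, m <= cross d x z + cross rho z y) -> m <= cross dmul x y.
Proof. exact: le_f. Qed.

End product.

Definition quasi_equiv (d1 d2 : dmetric X) :=
  exists alpha beta : R, [/\ 0 < alpha, 1 <= beta &
    forall x y : X, - alpha + beta^-1 * cross d1 x y <= cross d2 x y
                    /\ cross d2 x y <= alpha + beta * cross d1 x y].

Lemma quasi_equiv_refl d : quasi_equiv d d.
Proof. by exists 1, 1; split => // x y; rewrite invr1; split; lra. Qed.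

Lemma quasi_equiv_sym d1 d2 : quasi_equiv d1 d2 -> quasi_equiv d2 d1.
Proof.
move=> [a [b [a0 b1 h]]]; have b0 : 0 < b by exact: lt_le_trans b1.
exists (a * b), b; split => [||x y]; [exact: mulr_gt0|by []|].
have [h1 h2] := h x y; split.
- rewrite addrC lerBlDr mulrC ler_pdivrMr//.
  have : 1 <= b * b by exact: mulr_ege1.
  by move: a0 h2; nra.
- have : cross d1 x y / b <= cross d2 x y + a by rewrite mulrC; move: h1; lra.
  by rewrite ler_pdivrMr//; lra.
Qed.

Lemma quasi_equiv_trans d2 d1 d3 :
  quasi_equiv d1 d2 -> quasi_equiv d2 d3 -> quasi_equiv d1 d3.
Proof.
move=> [a [b [a0 b1 h]]] [a' [b' [a'0 b'1 k]]].
have b0 : 0 < b by exact: lt_le_trans b1.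
have b'0 : 0 < b' by exact: lt_le_trans b'1.
exists (a' + b' * a), (b' * b); split => [||x y].
- by rewrite addr_gt0// mulr_gt0.
- exact: mulr_ege1.
have [h1 h2] := h x y; have [k1 k2] := k x y; split.
- apply: le_trans k1; rewrite invfM opprD -addrA lerD2l -mulrA.
  apply: (@le_trans _ _ (b'^-1 * (- a + b^-1 * cross d1 x y))); last first.
    by rewrite ler_pM2l ?invr_gt0.
  rewrite mulrDr lerD2r mulrN lerN2 ler_pM2r//.
  by apply: (le_trans _ b'1); rewrite invf_le1.
- apply: (le_trans k2); rewrite -addrA lerD2l -mulrA -mulrDr.
  by rewrite ler_pM2l.
Qed.

Lemma quasi_equiv_mul rho1 rho2 d1 d2 :
  quasi_equiv rho1 rho2 -> quasi_equiv d1 d2 ->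
  quasi_equiv (dmul rho1 d1) (dmul rho2 d2).
Proof.
have half r r' e e' : quasi_equiv r r' -> quasi_equiv e e' ->
    exists a b, [/\ 0 < a, 1 <= b & forall x y,
      cross (dmul r' e') x y <= a + b * cross (dmul r e) x y].
  move=> [a [b [a0 b1 h]]] [a' [b' [a'0 b'1 k]]].
  have B0 : 0 < b + b' by lra.
  exists (a + a'), (b + b'); split => [||x y]; [lra|lra|].
  rewrite -lerBlDl mulrC -ler_pdivrMr//; apply: le_cross_mul => z.
  rewrite ler_pdivrMr// lerBlDl.
  apply: (le_trans (cross_mul_le _ _ x y z)).
  have [_ h2] := h z y; have [_ k2] := k x z.
  have := cross_ge0 r z y; have := cross_ge0 e x z; nra.
move=> hr hd; have [a [b [a0 b1 h]]] := half _ _ _ _ hr hd.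
have [a' [b' [a'0 b'1 k]]] :=
  half _ _ _ _ (quasi_equiv_sym hr) (quasi_equiv_sym hd).
have B0 : 0 < b + b' by lra.
exists (a + a'), (b + b'); split => [||x y]; [lra|lra|].
have := h x y; have := k x y.
have := cross_ge0 (dmul rho1 d1) x y; have := cross_ge0 (dmul rho2 d2) x y.
move=> p1 p2 q1 q2; split; last by nra.
rewrite addrC lerBlDr mulrC ler_pdivrMr//; nra.
Qed.

Definition quasi_equivb d1 d2 := `[< quasi_equiv d1 d2 >].

Fact quasi_equivb_refl : reflexive quasi_equivb.
Proof. by move=> d; exact/asboolP/quasi_equiv_refl. Qed.

Fact quasi_equivb_sym : symmetric quasi_equivb.
Proof.
by move=> d e; apply/asboolP/asboolP; exact: quasi_equiv_sym.
Qed.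

Fact quasi_equivb_trans : transitive quasi_equivb.
Proof.
move=> e d f /asboolP h /asboolP k; exact/asboolP/(quasi_equiv_trans h k).
Qed.

Canonical quasi_equivb_equiv :=
  EquivRel quasi_equivb quasi_equivb_refl quasi_equivb_sym quasi_equivb_trans.

Definition Mq : Type := {eq_quot quasi_equivb}%qT.
HB.instance Definition _ := Choice.on Mq.
HB.instance Definition _ := EqQuotient.on Mq.

(* [d]_q *)
Definition qclass d : Mq := (\pi_Mq d)%qT.

Lemma qclassP d e : qclass d = qclass e <-> quasi_equiv d e.
Proof.
rewrite /qclass; split => [/eqP|h]; last apply/eqP.
  by rewrite eqmodE => /asboolP.
by rewrite eqmodE; exact/asboolP.
Qed.

Definition qmul (p q : Mq) : Mq := qclass (dmul (repr p) (repr q)).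

Lemma qmulE rho d : qmul (qclass rho) (qclass d) = qclass (dmul rho d).
Proof.
by apply/qclassP/quasi_equiv_mul; apply/qclassP; rewrite /qclass reprK.
Qed.

Definition qselfadjoint (p : Mq) := exists2 d, qclass d = p & adj d = d.

Definition qprojection (p : Mq) := qselfadjoint p /\ qmul p p = p.

(* d_X(x, A), equal to +oo when A is empty *)
Definition dist_to (A : set X) (x : X) : \bar R :=
  ereal_inf [set (mdist x a)%:E | a in A].

Definition nbhd (r : R) (A : set X) : set X :=
  [set x | (dist_to A x <= r%:E)%E].

(* Sequences are indexed by the positive integers, as the definition of
   delta_A starts with A_1: the value at 0 of A : nat -> set X is unused. *)
Definition expanding (A : nat -> set X) :=
  (exists2 n, (0 < n)%N & A n !=set0) /\
  (forall n, (0 < n)%N -> A n !=set0 -> nbhd 2^-1 (A n) `<=` A n.+1).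

Definition covering (A : nat -> set X) :=
  \bigcup_(n in [set n | (0 < n)%N]) A n = [set: X].

(* k is the value of delta_A at u *)
Definition is_delta (A : nat -> set X) (u : X) (k : nat) :=
  (A 1%N u /\ k = 1%N) \/
  (exists n, [/\ (0 < n)%N, (A n.+1 `\` A n) u & k = n.+1]).

Lemma is_delta_exists A : covering A -> forall u, exists k, is_delta A u k.
Proof.
move=> cA u; have : [set: X] u by [].
rewrite -cA => -[n]; case: n => // n _.
elim: n => [A1|n IH An]; first by exists 1%N; left.
have [|nA] := pselect (A n.+1 u); first exact: IH.
by exists n.+2; right; exists n.+1.
Qed.

Lemma expanding_le A n m : expanding A -> (0 < n)%N -> (n <= m)%N ->
  A n `<=` A m.
Proof.
move=> [_ e2] n0; elim: m => [|m IH]; first by case: n n0.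
rewrite leq_eqVlt => /orP[/eqP->//|]; rewrite ltnS => nm u Anu.
have Amu := IH nm u Anu; apply: (e2 m) => //; first exact: leq_trans nm.
  by exists u.
rewrite /nbhd /dist_to /=.
apply: (@le_trans _ _ (mdist u u)%:E); first by apply: ereal_inf_lbound; exists u.
by rewrite mdistxx lee_fin invr_ge0.
Qed.

Lemma is_delta_uniq A u k l :
  expanding A -> is_delta A u k -> is_delta A u l -> k = l.
Proof.
move=> eA [[A1 ->]|[n [n0 [Sn nAn] ->]]] [[A1' ->]|[m [m0 [Sm nAm] ->]]] //.
- by case: nAm; exact: (expanding_le eA _ m0) A1.
- by case: nAn; exact: (expanding_le eA _ n0) A1'.
- case: (ltngtP n m) => [nm|mn|->//].
  + by case: nAm; exact: (expanding_le eA _ nm) Sn.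
  + by case: nAn; exact: (expanding_le eA _ mn) Sm.
Qed.

Definition delta A (cA : covering A) (u : X) : nat :=
  sval (cid (is_delta_exists cA u)).

Lemma deltaP A (cA : covering A) u : is_delta A u (delta cA u).
Proof. exact: svalP. Qed.

(* The metric d_A *)
Section expanding_metric.
Variables (A : nat -> set X) (eA : expanding A) (cA : covering A).

Let f x y :=
  inf (range (fun u => mdist x u + (delta cA u)%:R + mdist u y)) : R.

Fact delta_ge1 u : 1 <= (delta cA u)%:R :> R.
Proof. by rewrite ler1n; case: (deltaP cA u) => [[_ ->]|[n [_ _ ->]]]. Qed.

Fact expanding_nonempty : exists x : X, True.
Proof. by case: eA => -[n _ [x _]] _; exists x. Qed.

Let f_le x y u : f x y <= mdist x u + (delta cA u)%:R + mdist u y.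
Proof.
by apply: (@inf_range_le _ _ _ 0) => v; rewrite !addr_ge0// mdist_ge0.
Qed.

Let le_f m x y :
  (forall u, m <= mdist x u + (delta cA u)%:R + mdist u y) -> m <= f x y.
Proof. by case: expanding_nonempty => t _; exact: inf_range_ge. Qed.

Fact dseq_ge : exists2 c, 0 < c & forall x y, c <= f x y.
Proof.
exists 1 => // x y; apply: le_f => u; have := delta_ge1 u.
by have := mdist_ge0 x u; have := mdist_ge0 u y; lra.
Qed.

Fact dseq_tri1 x z y : f x y <= mdist x z + f z y.
Proof.
rewrite -lerBlDl; apply: le_f => u.
by have := f_le x y u; have := metric_triangle x z u; lra.
Qed.

Fact dseq_tri2 x z y : f x y <= f x z + mdist z y.
Proof.
rewrite -lerBlDr; apply: le_f => u.
by have := f_le x y u; have := metric_triangle u z y; lra.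
Qed.

Let f_mdist x y : mdist x y <= f x y.
Proof.
apply: le_f => u; have := metric_triangle x u y; have := delta_ge1 u; lra.
Qed.

Fact dseq_tri3 x z y : mdist x z <= f x y + f z y.
Proof.
have := metric_triangle x y z; have := f_mdist x y; have := f_mdist z y.
by rewrite (metric_sym y z); lra.
Qed.

Fact dseq_tri4 y z x : mdist y z <= f x y + f x z.
Proof.
have := metric_triangle y x z; have := f_mdist x y; have := f_mdist x z.
by rewrite (metric_sym y x); lra.
Qed.

Definition dseq : dmetric X :=
  glue expanding_nonempty dseq_ge dseq_tri1 dseq_tri2 dseq_tri3 dseq_tri4.

Lemma cross_dseq x y : cross dseq x y =
  inf (range (fun u => mdist x u + (delta cA u)%:R + mdist u y)).
Proof. by []. Qed.

End expanding_metric.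

Definition levels (d : dmetric X) (n : nat) : set X :=
  [set x | cross d x x <= n%:R].

End dmetric_theory.

(* Main.v *)
Require Import Defs.
From mathcomp Require Import all_boot all_order all_algebra.
From mathcomp Require Import boolp classical_sets reals topology.
From mathcomp Require Import lra ereal.

(** Write [t] for the distance from [x] to [y'].  Going from [x] to [x'] through
    [y'] and back costs [2 t] in the product [d d], by selfadjointness; since
    [d d] is quasi-equivalent to [d], the diagonal distance from [x] to [x'] is
    at most affine in [t] ([diag_le_affine]), and likewise for [y].  So the
    diagonal of [d] controls [d]: [x] itself is a good enough midpoint in the
    infimum defining the metric of the sequence, because its index [delta] is
    the diagonal distance rounded up ([delta_levels_le]) and the distance in
    [X] between [x] and [y] is at most [t] plus the diagonal distance at [y].
    Conversely, any path from [x] to [u], across to [u'] and on to [y'] bounds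
    [d] from above by the triangle inequality ([cross_le_dseq]).

    The sequence is expanding because moving [x] by [r] changes the diagonal
    distance by at most [2 r] ([diag_lipschitz]); this is why the radius [1/2]
    matches a step of one in the index. *)

Set Implicit Arguments.
Unset Strict Implicit.
Unset Printing Implicit Defensive.

Import Order.TTheory GRing.Theory Num.Theory.

Local Open Scope classical_set_scope.
Local Open Scope ring_scope.

Section levels.
Context (R : realType) (X : metricType R).
Implicit Types d : dmetric X.

Lemma cross_le_via_diag d x u y :
  cross d x y <= mdist x u + cross d u u + mdist u y.
Proof.
have [h1 h2 _ _] := cross_triangle d.
by have := h1 x u y; have := h2 u u y; lra.
Qed.

Lemma diag_lipschitz d x y : cross d x x <= cross d y y + 2 * mdist x y.
Proof.
by have := cross_le_via_diag d x y x; rewrite (metric_sym y x); lra.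
Qed.

Lemma levels_covering d : covering (levels d).
Proof.
apply/seteqP; split => // x _; exists (Num.truncn (cross d x x)).+1 => //.
by rewrite /levels /=; exact/ltW/truncnS_gt.
Qed.

Lemma levels_expanding d : expanding (levels d).
Proof.
split.
  have [x _] := dmetric_nonempty d; have : [set: X] x by [].
  by rewrite -(levels_covering d) => -[n n0 dn]; exists n => //; exists x.
move=> n _ _ x; rewrite /nbhd /= => hx; rewrite /levels /=.
apply/ler_addgt0Pr => e e0.
(* The distance to a level need not be attained, so a point of the level is
   only found within 1/2 + e/2. *)
have : (dist_to (levels d n) x < (2^-1 + e / 2)%:E)%E.
  by apply: (le_lt_trans hx); rewrite lte_fin; lra.
move=> /ereal_inf_lt[_ [a + <-]].
rewrite /levels /= lte_fin => ha xa.
by have := diag_lipschitz d x a; rewrite -natr1; lra.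
Qed.

Section delta_bounds.
Variables (d : dmetric X) (cA : covering (levels d)).

Lemma diag_le_delta u : cross d u u <= (delta cA u)%:R.
Proof. by case: (deltaP cA u) => [[? ->]|[n [_ [? _] ->]]]. Qed.

Lemma delta_levels_le u : (delta cA u)%:R <= cross d u u + 1.
Proof.
case: (deltaP cA u) => [[_ ->]|[n [_ [_ nA] ->]]].
  by have := cross_ge0 d u u; lra.
by move/negP: nA; rewrite -ltNge -natr1 lerD2r => /ltW.
Qed.

End delta_bounds.

Lemma cross_le_dseq d (eA : expanding (levels d)) (cA : covering (levels d))
  x y : cross d x y <= cross (dseq eA cA) x y.
Proof.
rewrite cross_dseq; apply: (inf_range_ge x) => u.
by have := cross_le_via_diag d x u y; have := diag_le_delta cA u; lra.
Qed.

Lemma dseq_le_via_left (A : nat -> set X) (eA : expanding A) (cA : covering A)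
  x y : cross (dseq eA cA) x y <= (delta cA x)%:R + mdist x y.
Proof.
rewrite cross_dseq.
apply: le_trans (@inf_range_le _ _ _ 0 x _) _ => [u|].
  by rewrite !addr_ge0 ?mdist_ge0.
by rewrite mdistxx add0r.
Qed.

(** Evaluating the infimum in [dmul d d] at [y] for the pair [(x, x)] gives the
    sum of the distances from [x] to [y'] and from [y] to [x'], which are equal
    when [d] is selfadjoint. *)
Lemma diag_le_affine d : adj d = d -> quasi_equiv (dmul d d) d ->
  exists a b, [/\ 0 < a, 1 <= b & forall x y,
    cross d x x <= a + b * cross d x y /\ cross d y y <= a + b * cross d x y].
Proof.
move=> sa [a [b [a0 b1 h]]].
have sym x y : cross d x y = cross d y x by rewrite -{1}sa cross_adj.
have diag x y : cross d x x <= a + 2 * b * cross d x y.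
  have [_ h2] := h x x; have := cross_mul_le d d x x y.
  by rewrite (sym y x); nra.
exists a, (2 * b); split => [//||x y]; first by lra.
by split; [exact: diag|rewrite sym; exact: diag].
Qed.

End levels.

Theorem theorem2p3 (R : realType) (X : metricType R) (d : dmetric X) :
  adj d = d ->
  qprojection (qclass d) ->
  exists (eA : expanding (levels d)) (cA : covering (levels d)),
    quasi_equiv d (dseq eA cA).
Proof.
move=> sa [_]; rewrite qmulE => /qclassP idem.
have [a [b [a0 b1 diag]]] := diag_le_affine sa idem.
exists (levels_expanding d), (levels_covering d).
set eA := levels_expanding d; set cA := levels_covering d.
exists (2 * a + 1), (2 * b + 1); split => [||x y]; [lra|lra|].
split.
  have : (2 * b + 1)^-1 * cross d x y <= cross d x y.
    rewrite ler_piMl ?cross_ge0// invf_le1; lra.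
  by have := cross_le_dseq eA cA x y; lra.
have [dx dy] := diag x y.
have [_ _ tri _] := cross_triangle d.
have := tri x y y; have := dseq_le_via_left eA cA x y.
by have := delta_levels_le cA x; lra.
Qed.
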